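(* Consider the scalar initial value problem $w'(t)=\Phi(w)=\Phi_I(w)+\Phi_E(w)$, $t\in(0,T_{end})$, $w(0)=w_0$, with $\Phi_I,\Phi_E:\mathbb{R}\to\mathbb{R}$. Assume that $\Phi,\Phi_I,\Phi_E$ and $\dot\Phi,\dot\Phi_I,\dot\Phi_E$ are smooth and Lipschitz continuous. Let $Y^n$ be the vector of all stage and correction values generated by the method $\mathrm{HBPC}(q,k_{\max})$ with timestep $\Delta t=T_{end}/N$, let $W^n$ be the corresponding vector of exact solution values, and let $Z^n:=Y^n-W^n$. Then, provided $\Delta t$ is sufficiently small, there is a constant $C$, independent of $\Delta t$, $N$ and $n$, such that $$\|Z^n\|_\infty\le C\,\Delta t^2\qquad\text{for all }0\le n\le N,$$ i.e. the method is second-order convergent.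
   Context: Derivatives: $\dot\Phi(w):=\Phi'(w)\Phi(w)$, $\dot\Phi_I(w):=\Phi_I'(w)\Phi(w)$, $\dot\Phi_E(w):=\Phi_E'(w)\Phi(w)$. The exact solution $w$ is assumed sufficiently smooth. Grid: $\Delta t=T_{end}/N$, $t^n=n\Delta t$. Collocation data: $s\ge 2$, equidistant $c_l=(l-1)/(s-1)$, $1\le l\le s$ (so $c_1=0$, $c_s=1$), $q=2s$. The Butcher matrices $B^{(1)},B^{(2)}\in\mathbb{R}^{s\times s}$ are obtained by integrating the Hermite interpolation polynomial (degree $\le 2s-1$, matching values and first derivatives at $c_1,\dots,c_s$) over $[0,c_l]$: $\int_0^{c_l}p(\tau)\,d\tau=\sum_j B^{(1)}_{lj}p(c_j)+\sum_j B^{(2)}_{lj}p'(c_j)$ for every polynomial $p$ of degree $\le 2s-1$. Set $\mathcal I_l(\phi^1,\dots,\phi^s)=\Delta t\sum_j B^{(1)}_{lj}\phi^j+\Delta t^2\sum_j B^{(2)}_{lj}\dot\phi^j$, where $\dot\phi^j$ is the time derivative belonging to $\phi^j$ (for $\phi^j=\Phi(v)$, $\dot\phi^j=\dot\Phi(v)$). Method $\mathrm{HBPC}(q,k_{\max})$, $k_{\max}\ge1$: it computes $w^{n,[k],l}\approx w(t^n+c_l\Delta t)$, $0\le k\le k_{\max}$, $1\le l\le s$; write $\Phi^{n,[k],l}=\Phi(w^{n,[k],l})$, and similarly for $\Phi_I,\Phi_E$ and the dotted functions. Initialization: $w^{-1,[k],s}:=w_0$ for all $k$. For $n=0,1,\dots$: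 Predictor, for $1\le l\le s$: $w^{n,[0],l}=w^{n-1,[0],s}+c_l\Delta t(\Phi_I^{n,[0],l}+\Phi_E^{n-1,[0],s})+\frac{(c_l\Delta t)^2}{2}(\dot\Phi_E^{n-1,[0],s}-\dot\Phi_I^{n,[0],l})$. Corrector, for $0\le k<k_{\max}$: $w^{n,[k+1],1}=w^{n-1,[k+2],s}$, and for $2\le l\le s$: $w^{n,[k+1],l}=w^{n-1,[k+2],s}+\Delta t(\Phi_I^{n,[k+1],l}-\Phi_I^{n,[k],l})-\frac{\Delta t^2}{2}(\dot\Phi_I^{n,[k+1],l}-\dot\Phi_I^{n,[k],l})+\mathcal I_l(\Phi^{n,[k],1},\dots,\Phi^{n,[k],s})$; when $k=k_{\max}-1$ the index $k+2$ is replaced by $k_{\max}$. Vectors: $Y^{n+1}\in\mathbb{R}^{s(k_{\max}+1)}$ stacks $w^{n,[0],1},\dots,w^{n,[0],s},w^{n,[1],1},\dots,w^{n,[1],s},\dots,w^{n,[k_{\max}],s}$ for $n\ge0$, and $Y^0=(w_0,\dots,w_0)^T$. $W^{n+1}$ consists of $k_{\max}+1$ copies of the block $(w(t^n+c_1\Delta t),\dots,w(t^n+c_s\Delta t))^T$, and $W^0:=Y^0$. $\|\cdot\|_\infty$ is the maximum norm. *)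

(* Defs.v *)
From mathcomp Require Import all_boot all_order all_algebra.
From mathcomp Require Import all_classical all_reals all_analysis.

Set Implicit Arguments.
Unset Strict Implicit.
Unset Printing Implicit Defensive.

Import Order.TTheory GRing.Theory Num.Theory.
Import numFieldNormedType.Exports.

Local Open Scope classical_set_scope.
Local Open Scope ring_scope.

Definition smooth (R : realType) (f : R -> R) : Prop :=
  forall (k : nat) (x : R), derivable (derive1n k f) x 1.

(* C^oo up to the boundary: every derivative of [f] on ]a, b[ extends
   continuously to [a, b] ([f] itself being its own extension). *)
Definition smooth_on_segment (R : realType) (a b : R) (f : R -> R) : Prop :=
  {within `[a, b], continuous f} /\
  forall k : nat,
    (forall x, x \in `]a, b[ -> derivable (derive1n k f) x 1) /\
    exists g : R -> R, {within `[a, b], continuous g} /\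
      forall x, x \in `]a, b[ -> derive1n k f x = g x.

Definition smooth_lipschitz (R : realType) (f : R -> R) : Prop :=
  smooth f /\ [lipschitz f x | x in [set: R]].

(* d/dt g(w(t)) along a solution of w' = Phi(w), as a function of w. *)
Definition dot (R : realType) (Phi g : R -> R) (x : R) : R := derive1 g x * Phi x.

Definition exact_solution (R : realType) (Phi : R -> R) (w0 Tend : R)
    (w : R -> R) : Prop :=
  [/\ forall t, t \in `]0, Tend[ -> is_derive t (1 : R) w (Phi (w t)),
      w 0 = w0 &
      smooth_on_segment 0 Tend w].

(* Stages are numbered l = 1, ..., s; row and column i : 'I_s of the Butcher
   matrices belong to stage i.+1. *)
Definition colloc (R : realType) (s l : nat) : R := l.-1%:R / s.-1%:R.

Definition hermite_butcher (R : realType) (s : nat) (B1 B2 : 'M[R]_s) : Prop :=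
  forall p : {poly R}, (size p <= 2 * s)%N ->
  forall l : 'I_s,
    \int[lebesgue_measure]_(x in `[0, colloc R s l.+1]) p.[x] =
      \sum_(j < s) B1 l j * p.[colloc R s j.+1] +
      \sum_(j < s) B2 l j * p^`().[colloc R s j.+1].

Definition hermite_quad (R : realType) (s : nat) (B1 B2 : 'M[R]_s)
    (Phi : R -> R) (dt : R) (v : nat -> R) (l : 'I_s) : R :=
  dt * (\sum_(j < s) B1 l j * Phi (v j.+1)) +
  dt ^+ 2 * (\sum_(j < s) B2 l j * dot Phi Phi (v j.+1)).

(* The time index is shifted by one, so that [y n] holds the entries of Y^n:
   [y n.+1 k l] is w^{n,[k],l}, and [y 0 k l] is w_0; in particular
   w^{n-1,[k],s} is [y n k s] for every n >= 0.  Only the entries with n <= N,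
   k <= kmax and 1 <= l <= s are constrained.  The scheme is implicit, hence
   a relation. *)
Record HBPC (R : realType) (PhiI PhiE Phi : R -> R) (s kmax : nat)
    (B1 B2 : 'M[R]_s) (w0 dt : R) (N : nat) (y : nat -> nat -> nat -> R) :
    Prop := MkHBPC {
  hbpc_init : forall k l : nat, (k <= kmax)%N -> (1 <= l <= s)%N ->
    y 0%N k l = w0 ;
  hbpc_predictor : forall n l : nat, (n < N)%N -> (1 <= l <= s)%N ->
    y n.+1 0%N l =
      y n 0%N s
      + colloc R s l * dt * (PhiI (y n.+1 0%N l) + PhiE (y n 0%N s))
      + (colloc R s l * dt) ^+ 2 / 2
        * (dot Phi PhiE (y n 0%N s) - dot Phi PhiI (y n.+1 0%N l)) ;
  hbpc_corrector_first : forall n k : nat, (n < N)%N -> (k < kmax)%N ->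
    y n.+1 k.+1 1%N = y n (minn k.+2 kmax) s ;
  hbpc_corrector : forall n k : nat, (n < N)%N -> (k < kmax)%N ->
    forall l : 'I_s, (2 <= l.+1)%N ->
    y n.+1 k.+1 l.+1 =
      y n (minn k.+2 kmax) s
      + dt * (PhiI (y n.+1 k.+1 l.+1) - PhiI (y n.+1 k l.+1))
      - dt ^+ 2 / 2
        * (dot Phi PhiI (y n.+1 k.+1 l.+1) - dot Phi PhiI (y n.+1 k l.+1))
      + hermite_quad B1 B2 Phi dt (y n.+1 k) l }.

(* Values of the exact solution, with the same index shift as in [HBPC]. *)
Definition exact_values (R : realType) (s : nat) (w : R -> R) (w0 dt : R)
    (n k l : nat) : R :=
  if n is m.+1 then w (m%:R * dt + colloc R s l * dt) else w0.

Definition stack (R : realType) (kmax s : nat) (y : nat -> nat -> R) :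
    'cV[R]_(kmax.+1 * s) :=
  (mxvec (\matrix_(k < kmax.+1, l < s) y k l.+1))^T.

(* Main.v *)
(* Let E_n be the maximal error over all the entries of Y^n.  Since Phi, Phi_I,
   Phi_E and their dotted versions are Lipschitz, so are their compositions with
   the exact solution, which yields Taylor expansions along the flow without
   using any further derivative.  The predictor therefore has local error
   O(dt^3), and so has the corrector, for which it suffices that the Hermite
   quadrature is exact on 1 and X.  As each stage of step n+1 starts from some
   w^{n-1,[k],s}, the errors satisfy
     E_{n+1} <= E_n + A dt (E_n + E_{n+1}) + A dt^3,
   and a discrete Gronwall argument gives E_n <= C dt^2. *)
Require Import Defs.
From mathcomp Require Import all_boot all_order all_algebra.
From mathcomp Require Import all_classical all_reals all_analysis.
From mathcomp Require Import ring lra.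

Import Order.TTheory GRing.Theory Num.Theory.
Import numFieldNormedType.Exports.

Local Open Scope classical_set_scope.
Local Open Scope ring_scope.

Set Implicit Arguments.
Unset Strict Implicit.
Unset Printing Implicit Defensive.

(** * Taylor estimates with a Lipschitz top derivative *)

(** Differentiability is asked only inside the interval, since the exact solution satisfies its
    equation only on the open interval. *)
Lemma MVT_le (R : realType) (f df : R -> R) (a b M : R) : a <= b ->
  {within `[a, b], continuous f} ->
  (forall x, x \in `]a, b[ -> is_derive x 1 f (df x)) ->
  (forall x, x \in `]a, b[ -> `|df x| <= M) ->
  `|f b - f a| <= M * (b - a).
Proof.
rewrite le_eqVlt => /predU1P[<- _ _ _|ab cf fdf dfM].
  by rewrite !subrr normr0 mulr0.
have [c cab ->] := MVT ab fdf cf.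
rewrite normrM [X in _ * X]ger0_norm ?subr_ge0 ?(ltW ab)//.
by rewrite ler_wpM2r ?subr_ge0 ?(ltW ab)// dfM.
Qed.

(** Subtracting from [f] its linear part at [a] leaves the derivative [g x - g a], at most
    [K * (b - a)]; [MVT_le] supplies the second factor. *)
Lemma taylor1_le (R : realType) (f g : R -> R) (a b K : R) : a <= b -> 0 <= K ->
  {within `[a, b], continuous f} ->
  (forall x, x \in `]a, b[ -> is_derive x 1 f (g x)) ->
  (forall x, x \in `]a, b[ -> `|g x - g a| <= K * (x - a)) ->
  `|f b - f a - (b - a) * g a| <= K * (b - a) ^+ 2.
Proof.
move=> ab K0 cf fg gK.
pose h := f - (fun x => (x - a) * g a).
have -> : f b - f a - (b - a) * g a = h b - h a.
  by rewrite /h !fctE; ring.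
rewrite expr2 mulrA; apply: (@MVT_le _ _ (fun x => g x - g a)) => //.
- apply: within_continuousB => //; apply: continuous_subspaceT => x.
  by apply: cvgMl; apply: cvgB => //; exact: cvg_cst.
- move=> x /fg fgx; apply: is_deriveB.
  by apply: is_derive_eq; rewrite scaler0 add0r oppr0 addr0 [LHS]mulr1.
- move=> x xab; apply: le_trans (gK x xab) _.
  move: xab; rewrite in_itv/= => /andP[ax xb].
  by rewrite ler_wpM2l// lerD2r ltW.
Qed.

(** One order higher: once the quadratic Taylor polynomial is subtracted from [u], the derivative is
    the first-order remainder of [f], which [taylor1_le] controls on each [[a, x]]. *)
Lemma taylor2_le (R : realType) (u f g : R -> R) (a b K : R) : a <= b -> 0 <= K ->
  {within `[a, b], continuous u} -> {within `[a, b], continuous f} ->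
  (forall x, x \in `]a, b[ -> is_derive x 1 u (f x)) ->
  (forall x, x \in `]a, b[ -> is_derive x 1 f (g x)) ->
  (forall x, x \in `]a, b[ -> `|g x - g a| <= K * (x - a)) ->
  `|u b - u a - (b - a) * f a - (b - a) ^+ 2 / 2 * g a| <= K * (b - a) ^+ 3.
Proof.
move=> ab K0 cu cf uf fg gK.
pose h := u - (fun x => (x - a) * f a + (x - a) ^+ 2 / 2 * g a).
have -> : u b - u a - (b - a) * f a - (b - a) ^+ 2 / 2 * g a = h b - h a.
  by rewrite /h !fctE; field.
rewrite exprS mulrCA mulrC.
apply: (@MVT_le _ _ (fun x => f x - f a - (x - a) * g a)) => //.
- apply: within_continuousB => //; apply: continuous_subspaceT => x.
  have xa : (x - a) @[x --> x] --> x - a by apply: cvgB => //; exact: cvg_cst.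
  by apply: cvgD; apply: cvgMl => //; apply: cvgMl; apply: cvgM.
- move=> x /uf ufx; rewrite -addrA -opprD; apply: is_deriveB.
  by apply: is_derive_eq; rewrite /GRing.scale/=; field.
- move=> x; rewrite in_itv/= => /andP[ax xb].
  have sub : `[a, x] `<=` `[a, b].
    by apply: subset_itv; rewrite ?bnd_simp// ltW.
  have subo y : y \in `]a, x[ -> y \in `]a, b[.
    by rewrite !in_itv/= => /andP[-> yx]; rewrite (lt_trans yx).
  apply: le_trans (_ : K * (x - a) ^+ 2 <= _).
    apply: taylor1_le (ltW ax) _ _ _ _ => //.
    + exact: continuous_subspaceW cf.
    + by move=> y /subo; exact: fg.
    + by move=> y /subo; exact: gK.
  by rewrite ler_wpM2l// lerXn2r ?nnegrE ?subr_ge0 ?lerD2r// ltW// (lt_trans ax).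
Qed.

(** * Regularity of the exact solution and expansions along the flow *)

(** The Lipschitz notation quantifies over all constants near infinity; one nonnegative constant is
    extracted from it. *)
Lemma lipschitz_bound (R : realType) (f : R -> R) : [lipschitz f x | x in [set: R]] ->
  exists2 L : R, 0 <= L & forall x y, `|f x - f y| <= L * `|x - y|.
Proof.
move=> /pinfty_ex_gt0[L /ltW L0 fL]; exists L => // x y.
exact: (fL (x, y)).
Qed.

Lemma smooth_derivable (R : realType) (f : R -> R) x : smooth f -> derivable f x 1.
Proof. by move=> /(_ 0 x). Qed.

Lemma smooth_continuous (R : realType) (f : R -> R) : smooth f -> continuous f.
Proof.
by move=> sf x; apply/differentiable_continuous/derivable1_diffP/smooth_derivable.
Qed.

Lemma exact_solution_continuous (R : realType) (Phi : R -> R) (w0 T : R)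
    (w : R -> R) :
  exact_solution Phi w0 T w -> {within `[0, T], continuous w}.
Proof. by case=> _ _ []. Qed.

Lemma exact_solution_comp_continuous (R : realType) (Phi g : R -> R) (w0 T : R)
    (w : R -> R) : exact_solution Phi w0 T w -> smooth g ->
  {within `[0, T], continuous (g \o w)}.
Proof.
move=> hw sg; apply: within_continuous_comp (exact_solution_continuous hw).
by move=> x _; exact: smooth_continuous.
Qed.

(** The continuous function [|Phi (w t)|] attains its maximum on the compact interval, and this
    maximum bounds the derivative of [w]. *)
Lemma exact_solution_lipschitz (R : realType) (Phi : R -> R) (w0 T : R)
    (w : R -> R) : 0 <= T -> smooth Phi -> exact_solution Phi w0 T w ->
  exists2 M : R, 0 <= M & forall a b, 0 <= a -> a <= b -> b <= T ->
    `|w b - w a| <= M * (b - a).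
Proof.
move=> T0 sPhi hw; have cw := exact_solution_continuous hw.
have cPw : {within `[0, T], continuous (Num.norm \o (Phi \o w))}.
  apply: within_continuous_comp (exact_solution_comp_continuous hw sPhi).
  by move=> x _; exact: norm_continuous.
have [c _ cM] := EVT_max T0 cPw.
exists (`|Phi (w c)|) => // a b a0 ab bT.
apply: (@MVT_le _ _ (Phi \o w)) => //.
- by apply: continuous_subspaceW cw; apply: subset_itv; rewrite bnd_simp.
- case: hw => dw _ _ x; rewrite in_itv/= => /andP[ax xb].
  by apply: dw; rewrite in_itv/= (le_lt_trans a0 ax) (lt_le_trans xb bT).
- move=> x; rewrite in_itv/= => /andP[ax xb]; apply: cM.
  by rewrite in_itv/= (le_trans a0 (ltW ax)) (le_trans (ltW xb) bT).
Qed.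

Lemma exact_solution_is_derive_comp (R : realType) (Phi g : R -> R) (w0 T : R)
    (w : R -> R) t : exact_solution Phi w0 T w -> smooth g -> t \in `]0, T[ ->
  is_derive t 1 (g \o w) (dot Phi g (w t)).
Proof.
case=> dw _ _ sg /dw wt; rewrite /dot derive1E; apply: is_derive1_comp.
by apply: derivableP; exact: smooth_derivable.
Qed.

(** With a dotted function for [g], this is the bound on the top derivative that the Taylor lemmas
    require. *)
Lemma flow_lipschitz (R : realType) (Phi : R -> R) (w0 T : R) (w : R -> R)
    (g : R -> R) (T0 : 0 <= T) (sPhi : smooth Phi)
    (hw : exact_solution Phi w0 T w) :
  [lipschitz g x | x in [set: R]] ->
  exists2 K : R, 0 <= K & forall a h, 0 <= a -> 0 <= h -> a + h <= T ->
    `|g (w (a + h)) - g (w a)| <= K * h.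
Proof.
move=> /lipschitz_bound[L L0 gL].
have [M M0 wM] := exact_solution_lipschitz T0 sPhi hw.
exists (L * M); first exact: mulr_ge0.
move=> a h a0 h0 ahT; apply: le_trans (gL _ _) _; rewrite -mulrA ler_wpM2l//.
have := wM a (a + h); rewrite lerDl (addrC a h) addrK; apply => //.
by rewrite addrC.
Qed.

(** By the chain rule [dot Phi g \o w] is the derivative of [g \o w], so [taylor1_le] applies. *)
Lemma flow_taylor1 (R : realType) (Phi : R -> R) (w0 T : R) (w : R -> R)
    (g : R -> R) (T0 : 0 <= T) (sPhi : smooth Phi)
    (hw : exact_solution Phi w0 T w) :
  smooth g ->
  [lipschitz dot Phi g x | x in [set: R]] ->
  exists2 K : R, 0 <= K & forall a h, 0 <= a -> 0 <= h -> a + h <= T ->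
    `|g (w (a + h)) - g (w a) - h * dot Phi g (w a)| <= K * h ^+ 2.
Proof.
move=> sg /(flow_lipschitz T0 sPhi hw)[K K0 dK]; exists K => // a h a0 h0 ahT.
(* The step is written as a difference of endpoints only where [taylor1_le] expects one; the [h] in
   [w (a + h)] stays. *)
have hE : h = a + h - a by rewrite addrC addKr.
rewrite [X in X * dot _ _ _]hE [X in _ <= K * X ^+ 2]hE.
apply: (@taylor1_le _ (g \o w) (dot Phi g \o w)) => //.
- by rewrite lerDl.
- apply: continuous_subspaceW (exact_solution_comp_continuous hw sg).
  by apply: subset_itv; rewrite bnd_simp.
- move=> x; rewrite in_itv/= => /andP[ax xb].
  apply: exact_solution_is_derive_comp hw sg _.
  by rewrite in_itv/= (le_lt_trans a0 ax) (lt_le_trans xb ahT).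
- move=> x; rewrite in_itv/= => /andP[ax xb].
  by have := dK a (x - a) a0; rewrite (addrC a) subrK; apply; lra.
Qed.

(** Here [w' = Phi \o w] and [w'' = dot Phi Phi \o w]. *)
Lemma flow_taylor2 (R : realType) (Phi : R -> R) (w0 T : R) (w : R -> R)
    (T0 : 0 <= T) (sPhi : smooth Phi)
    (hw : exact_solution Phi w0 T w) :
  [lipschitz dot Phi Phi x | x in [set: R]] ->
  exists2 K : R, 0 <= K & forall a h, 0 <= a -> 0 <= h -> a + h <= T ->
    `|w (a + h) - w a - h * Phi (w a) - h ^+ 2 / 2 * dot Phi Phi (w a)|
      <= K * h ^+ 3.
Proof.
move=> /(flow_lipschitz T0 sPhi hw)[K K0 dK]; exists K => // a h a0 h0 ahT.
have hE : h = a + h - a by rewrite addrC addKr.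
rewrite [X in X * Phi _]hE [X in X ^+ 2 / 2]hE [X in _ <= K * X ^+ 3]hE.
have sub x : x \in `]a, a + h[ -> x \in `]0, T[.
  rewrite !in_itv/= => /andP[ax xb].
  by rewrite (le_lt_trans a0 ax) (lt_le_trans xb ahT).
have subc : `[a, a + h] `<=` `[0, T] by apply: subset_itv; rewrite bnd_simp.
apply: (@taylor2_le _ w (Phi \o w) (dot Phi Phi \o w)) => //.
- by rewrite lerDl.
- exact: continuous_subspaceW (exact_solution_continuous hw).
- exact: continuous_subspaceW (exact_solution_comp_continuous hw sPhi).
- by case: hw => dw _ _ x /sub; exact: dw.
- by move=> x /sub; exact: exact_solution_is_derive_comp hw sPhi.
- move=> x; rewrite in_itv/= => /andP[ax xb].
  by have := dK a (x - a) a0; rewrite (addrC a) subrK; apply; lra.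
Qed.

(** * Discrete Gronwall inequality *)

(** With [u = A * d <= 1 / 2] the implicit term can be absorbed on the left, which gives an explicit
    recursion with factor [1 + 4 * u] and source [2 * u * d ^+ 2]. *)
Lemma implicit_gronwall (R : realType) (E : nat -> R) (A d : R) (N : nat) :
  0 <= A -> 0 <= d -> A * d <= 1 / 2 -> (forall n, 0 <= E n) -> E 0%N = 0 ->
  (forall n, (n < N)%N ->
    E n.+1 <= E n + A * d * (E n + E n.+1) + A * d ^+ 3) ->
  forall n, (n <= N)%N -> E n <= expR (4 * A * (n%:R * d)) / 2 * d ^+ 2.
Proof.
move=> A0 d0 Ad E_ge0 E0 ES n nN; set u := A * d.
have u0 : 0 <= u by exact: mulr_ge0.
have d20 : 0 <= d ^+ 2 by exact: sqr_ge0.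
(* The right-hand side solves this recursion with equality from the initial value 0. *)
have geom m : (m <= N)%N -> E m <= ((1 + 4 * u) ^+ m - 1) / 2 * d ^+ 2.
  elim: m => [_|m IH mN]; first by rewrite E0 expr0 subrr !mul0r.
  have step : E m.+1 <= (1 + 4 * u) * E m + 2 * u * d ^+ 2.
    have := ES m mN; rewrite -/u => Em.
    (* This is exactly the slack between the claimed bound multiplied by [1 - u] and the hypothesis
       [(1 + u) * E m + u * d ^+ 2]. *)
    have uE : 0 <= u * (1 - 2 * u) * (2 * E m + d ^+ 2).
      have v0 : 0 <= 1 - 2 * u by rewrite /u; lra.
      by rewrite mulr_ge0 ?addr_ge0 ?(mulr_ge0 u0 v0)// mulr_ge0.
    rewrite -(@ler_pM2l _ (1 - u)); last by rewrite /u; lra.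
    have -> : (1 - u) * ((1 + 4 * u) * E m + 2 * u * d ^+ 2) =
      (1 + u) * E m + u * d ^+ 2 + u * (1 - 2 * u) * (2 * E m + d ^+ 2) by ring.
    have uE3 : A * d ^+ 3 = u * d ^+ 2 by rewrite /u; ring.
    by rewrite uE3 in Em; lra.
  apply: le_trans step _.
  have q0 : 0 <= 1 + 4 * u by lra.
  have := ler_wpM2l q0 (IH (ltnW mN)).
  set X := (1 + 4 * u) ^+ m.
  have -> : ((1 + 4 * u) ^+ m.+1 - 1) / 2 * d ^+ 2 =
    (1 + 4 * u) * ((X - 1) / 2 * d ^+ 2) + 2 * u * d ^+ 2.
    by rewrite exprS -/X; field.
  by rewrite lerD2r.
apply: le_trans (geom n nN) _; apply: ler_wpM2r => //; apply: ler_wpM2r => //.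
(* After dropping the [- 1], the inequality [1 + x <= expR x] turns the power into an exponential of
   the elapsed time [n%:R * d]. *)
apply: le_trans (_ : (1 + 4 * u) ^+ n <= _); first by lra.
rewrite (_ : 4 * A * (n%:R * d) = n%:R * (4 * u)); last by rewrite /u; ring.
rewrite expRM_natl; apply: lerXn2r; rewrite ?nnegrE ?expR_ge0 ?expR_ge1Dx//.
by lra.
Qed.

(** * The maximum norm of stacked vectors *)

(** The norm is an iterated maximum with default value 0, hence the condition on [r]. *)
Lemma mx_norm_leP (R : realType) (m n : nat) (A : 'M[R]_(m, n)) (r : R) : 0 <= r ->
  reflect (forall i j, `|A i j| <= r) (`|A| <= r).
Proof.
move=> r0; rewrite [in X in reflect _ X]/Num.norm/= mx_normrE.
apply: (iffP (bigmax_leP _ _ _ _)) => [[_ Ar] i j|Ar]; first exact: (Ar (i, j)).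
by split=> // -[i j] _; exact: Ar.
Qed.

(** Translates between vector entries and the numbering of the scheme: stage [l.+1] sits in column
    [l]. *)
Lemma stackB_leP (R : realType) (kmax s : nat) (x y : nat -> nat -> R) (r : R) :
  0 <= r ->
  reflect (forall k l, (k <= kmax)%N -> (1 <= l <= s)%N -> `|x k l - y k l| <= r)
    (`|stack kmax s x - stack kmax s y| <= r).
Proof.
move=> r0; apply: (iffP (mx_norm_leP _ r0)) => [xyr k [|l]// kk ls|xyr i j].
  have kk' : (k < kmax.+1)%N by [].
  have := xyr (mxvec_index (Ordinal kk') (Ordinal ls)) 0.
  by rewrite /stack !mxE !mxvecE !mxE.
case/mxvec_indexP: i => k l; rewrite (ord1 j) /stack 4!mxE !mxvecE !mxE.
by apply: xyr; [exact: (ltn_ord k) | exact: (ltn_ord l)].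
Qed.

(** * Collocation points and order conditions of the quadrature *)

Lemma colloc_ge0 (R : realType) (s l : nat) : 0 <= colloc R s l.
Proof. by rewrite /colloc divr_ge0. Qed.

Lemma colloc_gt0 (R : realType) (s l : nat) : (2 <= s)%N -> (2 <= l)%N ->
  0 < colloc R s l.
Proof.
by case: s => [|[]]//; case: l => [|[]]// l s _ _; rewrite /colloc divr_gt0 ?ltr0n.
Qed.

Lemma colloc_le1 (R : realType) (s l : nat) : (2 <= s)%N -> (l <= s)%N ->
  colloc R s l <= 1.
Proof.
case: s => [|[]]// s _ ls; rewrite /colloc ler_pdivrMr//= mul1r ler_nat.
by case: l ls.
Qed.

Lemma colloc1 (R : realType) (s : nat) : colloc R s 1 = 0.
Proof. by rewrite /colloc mul0r. Qed.

Lemma colloc_last (R : realType) (s : nat) : (2 <= s)%N -> colloc R s s = 1.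
Proof. by case: s => [|[]]// s _; rewrite /colloc divff ?pnatr_eq0. Qed.

Lemma Rintegral_id (R : realType) (c : R) : 0 < c ->
  \int[lebesgue_measure]_(x in `[0, c]) x = c ^+ 2 / 2.
Proof.
move=> c0; pose F (x : R) := x ^+ 2 / 2.
have dF (x : R) : is_derive x 1 F x.
  by apply: is_derive_eq; rewrite /GRing.scale/=; field.
have cF : continuous F.
  by move=> x; apply/differentiable_continuous/derivable1_diffP.
rewrite /Rintegral (@continuous_FTC2 _ _ F)//=.
- by rewrite /F expr0n/= mul0r subr0.
- by apply: continuous_subspaceT => x; exact: cvg_id.
- split=> [x _| |].
  + by have := dF x; case.
  + by apply: cvg_at_right_filter; exact: cF.
  + by apply: cvg_at_left_filter; exact: cF.
- by move=> x _; rewrite derive1E; exact: derive_val.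
Qed.

(** First order condition, from exactness on the polynomial 1, whose derivative removes the [B2]
    sum. *)
Lemma hermite_butcher_sum1 (R : realType) (s : nat) (B1 B2 : 'M[R]_s) (l : 'I_s) :
  (2 <= s)%N -> (2 <= l.+1)%N -> hermite_butcher B1 B2 ->
  \sum_(j < s) B1 l j = colloc R s l.+1.
Proof.
move=> s2 l2 /(_ 1%:P); rewrite size_polyC oner_eq0 /=.
rewrite muln_gt0/= (ltnW s2) => /(_ isT l).
have c0 := colloc_gt0 R s2 l2.
under [\sum_(j < s) B1 l j * _]eq_bigr do rewrite hornerC mulr1.
rewrite [X in _ = _ + X]big1 ?addr0 => [<-|j _]; last first.
  by rewrite derivC horner0 mulr0.
under eq_Rintegral do rewrite hornerC.
by rewrite Rintegral_cst//= lebesgue_measure_itv/= lte_fin c0 sube0 mul1r.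
Qed.

(** Second order condition, from exactness on ['X], whose derivative 1 brings in the row sum of
    [B2]. *)
Lemma hermite_butcher_sumX (R : realType) (s : nat) (B1 B2 : 'M[R]_s) (l : 'I_s) :
  (2 <= s)%N -> (2 <= l.+1)%N -> hermite_butcher B1 B2 ->
  \sum_(j < s) B1 l j * colloc R s j.+1 + \sum_(j < s) B2 l j =
    colloc R s l.+1 ^+ 2 / 2.
Proof.
move=> s2 l2 /(_ 'X); rewrite size_polyX -[X in (X <= _)%N]muln1 leq_mul2l/= (ltnW s2).
move=> /(_ isT l).
have c0 := colloc_gt0 R s2 l2.
under eq_Rintegral do rewrite hornerX.
rewrite Rintegral_id// => ->; congr (_ + _); apply: eq_bigr => j _.
  by rewrite hornerX.
by rewrite derivX hornerC mulr1.
Qed.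

(** * Stability and consistency of the quadrature *)

(** Summing over all rows is cruder than the maximal row sum, but bounds every row at once and keeps
    the constants independent of the stage. *)
Definition mxnorm1 (R : realType) (m n : nat) (B : 'M[R]_(m, n)) : R :=
  \sum_(i < m) \sum_(j < n) `|B i j|.

Lemma mxnorm1_ge0 (R : realType) (m n : nat) (B : 'M[R]_(m, n)) : 0 <= mxnorm1 B.
Proof. by rewrite sumr_ge0// => i _; rewrite sumr_ge0. Qed.

Lemma row_sum_le (R : realType) (m n : nat) (B : 'M[R]_(m, n)) (x : 'I_n -> R)
    (r : R) (l : 'I_m) : 0 <= r -> (forall j, `|x j| <= r) ->
  `|\sum_(j < n) B l j * x j| <= mxnorm1 B * r.
Proof.
move=> r0 xr; apply: le_trans (ler_norm_sum _ _ _) _.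
apply: le_trans (_ : (\sum_(j < n) `|B l j|) * r <= _).
  by rewrite mulr_suml; apply: ler_sum => j _; rewrite normrM ler_wpM2l.
rewrite ler_wpM2r// /mxnorm1 (bigD1 l)//= lerDl sumr_ge0// => i _.
by rewrite sumr_ge0.
Qed.

(** Stability: the factors [d] and [d ^+ 2] make a stage error [D] enter the step only as
    [O(d * D)]. *)
Lemma hermite_quad_lipschitz (R : realType) (s : nat) (B1 B2 : 'M[R]_s)
    (Phi : R -> R) (d L D : R) (u v : nat -> R) (l : 'I_s) :
  0 <= d -> 0 <= L -> 0 <= D ->
  (forall x y, `|Phi x - Phi y| <= L * `|x - y|) ->
  (forall x y, `|dot Phi Phi x - dot Phi Phi y| <= L * `|x - y|) ->
  (forall j : 'I_s, `|u j.+1 - v j.+1| <= D) ->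
  `|hermite_quad B1 B2 Phi d u l - hermite_quad B1 B2 Phi d v l| <=
    (d * mxnorm1 B1 + d ^+ 2 * mxnorm1 B2) * (L * D).
Proof.
move=> d0 L0 D0 lip1 lip2 uv.
have -> : hermite_quad B1 B2 Phi d u l - hermite_quad B1 B2 Phi d v l =
    d * \sum_(j < s) B1 l j * (Phi (u j.+1) - Phi (v j.+1)) +
    d ^+ 2 * \sum_(j < s) B2 l j * (dot Phi Phi (u j.+1) - dot Phi Phi (v j.+1)).
  under eq_bigr do rewrite mulrBr; rewrite sumrB.
  under [X in _ = _ + _ * X]eq_bigr do rewrite mulrBr; rewrite sumrB.
  by rewrite /hermite_quad; ring.
have LD0 : 0 <= L * D by exact: mulr_ge0.
apply: le_trans (ler_normD _ _) _; rewrite mulrDl; apply: lerD.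
- rewrite normrM (ger0_norm d0) -mulrA ler_wpM2l// row_sum_le// => j.
  by apply: le_trans (lip1 _ _) _; rewrite ler_wpM2l.
- rewrite normrM ger0_norm ?sqr_ge0// -mulrA ler_wpM2l ?sqr_ge0// row_sum_le// => j.
  by apply: le_trans (lip2 _ _) _; rewrite ler_wpM2l.
Qed.

(** Expanding the integrand values around [a], the two order conditions reproduce the quadratic
    Taylor polynomial of [w]. What is left is its remainder and weighted sums of the remainders
    [r1 = O(d ^+ 2)] and [r0 = O(d)], multiplied by [d] and [d ^+ 2]. *)
Lemma hermite_quad_consistent (R : realType) (s : nat) (B1 B2 : 'M[R]_s)
    (Phi w : R -> R) (a d K : R) (l : 'I_s) :
  (2 <= s)%N -> (2 <= l.+1)%N -> hermite_butcher B1 B2 -> 0 <= d -> 0 <= K ->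
  (forall h, 0 <= h <= d ->
    `|w (a + h) - w a - h * Phi (w a) - h ^+ 2 / 2 * dot Phi Phi (w a)|
      <= K * h ^+ 3) ->
  (forall h, 0 <= h <= d ->
    `|Phi (w (a + h)) - Phi (w a) - h * dot Phi Phi (w a)| <= K * h ^+ 2) ->
  (forall h, 0 <= h <= d ->
    `|dot Phi Phi (w (a + h)) - dot Phi Phi (w a)| <= K * h) ->
  `|w (a + colloc R s l.+1 * d) - w a
    - hermite_quad B1 B2 Phi d (fun j => w (a + colloc R s j * d)) l|
    <= K * (1 + mxnorm1 B1 + mxnorm1 B2) * d ^+ 3.
Proof.
move=> s2 l2 hB d0 K0 T2 T1 T0.
have cd (j : 'I_s) : 0 <= colloc R s j.+1 * d <= d.
  by rewrite mulr_ge0 ?colloc_ge0//= ler_piMl// colloc_le1.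
set P := Phi (w a) in T2 T1 *; set Q := dot Phi Phi (w a) in T2 T1 T0 *.
pose r1 (j : 'I_s) := Phi (w (a + colloc R s j.+1 * d)) - P - colloc R s j.+1 * d * Q.
pose r0 (j : 'I_s) := dot Phi Phi (w (a + colloc R s j.+1 * d)) - Q.
have hqE : hermite_quad B1 B2 Phi d (fun j => w (a + colloc R s j * d)) l =
    colloc R s l.+1 * d * P + (colloc R s l.+1 * d) ^+ 2 / 2 * Q
    + (d * (\sum_(j < s) B1 l j * r1 j) + d ^+ 2 * (\sum_(j < s) B2 l j * r0 j)).
  have e1 : \sum_(j < s) B1 l j * Phi (w (a + colloc R s j.+1 * d)) =
    (\sum_(j < s) B1 l j) * P + (\sum_(j < s) B1 l j * colloc R s j.+1) * (d * Q)
      + \sum_(j < s) B1 l j * r1 j.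
    by rewrite !mulr_suml -!big_split/=; apply: eq_bigr => j _; rewrite /r1; ring.
  have e2 : \sum_(j < s) B2 l j * dot Phi Phi (w (a + colloc R s j.+1 * d)) =
    (\sum_(j < s) B2 l j) * Q + \sum_(j < s) B2 l j * r0 j.
    by rewrite mulr_suml -big_split/=; apply: eq_bigr => j _; rewrite /r0; ring.
  rewrite /hermite_quad e1 e2.
  have := hermite_butcher_sumX s2 l2 hB.
  rewrite (hermite_butcher_sum1 s2 l2 hB) => sX.
  have -> : (colloc R s l.+1 * d) ^+ 2 / 2 = colloc R s l.+1 ^+ 2 / 2 * d ^+ 2 by ring.
  by rewrite -sX; ring.
rewrite hqE !opprD !addrA.
have le3 (j : 'I_s) k : (colloc R s j.+1 * d) ^+ k <= d ^+ k.
  by have /andP[? ?] := cd j; rewrite lerXn2r.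
have Kd k : 0 <= K * d ^+ k by rewrite mulr_ge0// exprn_ge0.
have -> : K * (1 + mxnorm1 B1 + mxnorm1 B2) * d ^+ 3 =
   K * d ^+ 3 + d * (mxnorm1 B1 * (K * d ^+ 2))
   + d ^+ 2 * (mxnorm1 B2 * (K * d)) by ring.
apply: le_trans (ler_normB _ _) _; apply: lerD.
  apply: le_trans (ler_normB _ _) _; apply: lerD.
    by apply: le_trans (T2 _ (cd l)) _; rewrite ler_wpM2l.
  rewrite normrM (ger0_norm d0) ler_wpM2l// row_sum_le// => j.
  by apply: le_trans (T1 _ (cd j)) _; rewrite ler_wpM2l.
rewrite normrM ger0_norm ?sqr_ge0// ler_wpM2l ?sqr_ge0// row_sum_le ?mulr_ge0// => j.
by apply: le_trans (T0 _ (cd j)) _; rewrite ler_wpM2l//; case/andP: (cd j).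
Qed.

(** * One-step error of predictor and corrector *)

(** Expanding the implicit value [PhiI wb] at [wa] produces [h ^+ 2 * DI wa], and the term
    [- h ^+ 2 / 2 * DI wb] cancels half of it; together with the explicit part this is the quadratic
    Taylor polynomial of the solution. Each of the three remainders is at most [K * h ^+ 3]. *)
Lemma predictor_error (R : realType) (PhiI PhiE Phi DI DE D : R -> R)
    (Y y0 wb wa h d E E' L K : R) :
  0 <= h <= d -> d <= 1 -> 0 <= L -> 0 <= K ->
  (forall x, Phi x = PhiI x + PhiE x) -> (forall x, D x = DI x + DE x) ->
  (forall x y, `|PhiI x - PhiI y| <= L * `|x - y|) ->
  (forall x y, `|PhiE x - PhiE y| <= L * `|x - y|) ->
  (forall x y, `|DI x - DI y| <= L * `|x - y|) ->
  (forall x y, `|DE x - DE y| <= L * `|x - y|) ->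
  `|wb - wa - h * Phi wa - h ^+ 2 / 2 * D wa| <= K * h ^+ 3 ->
  `|PhiI wb - PhiI wa - h * DI wa| <= K * h ^+ 2 ->
  `|DI wb - DI wa| <= K * h ->
  `|y0 - wa| <= E -> `|Y - wb| <= E' ->
  Y = y0 + h * (PhiI Y + PhiE y0) + h ^+ 2 / 2 * (DE y0 - DI Y) ->
  `|Y - wb| <= E + 2 * L * d * (E + E') + 3 * K * d ^+ 3.
Proof.
move=> /andP[h0 hd] d1 L0 K0 PE DE' lI lE lDI lDE.
set r2 := (X in `|X|); set r1 := (X in _ -> `|X| <= _ -> _).
set r0 := (X in _ -> _ -> `|X| <= _ -> _) => hr2 hr1 hr0 hE hE' Yeq.
have lip (f : R -> R) x y e : (forall x y, `|f x - f y| <= L * `|x - y|) ->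
    `|x - y| <= e -> `|f x - f y| <= L * e.
  by move=> fL xye; apply: le_trans (fL _ _) _; rewrite ler_wpM2l.
(* Inherited error, Lipschitz differences of the functions and of their dotted versions, and the
   defect of the exact solution in the scheme. *)
have -> : Y - wb = (y0 - wa)
    + h * ((PhiI Y - PhiI wb) + (PhiE y0 - PhiE wa))
    + h ^+ 2 / 2 * ((DE y0 - DE wa) - (DI Y - DI wb))
    + (h * r1 - r2 - h ^+ 2 / 2 * r0).
  by rewrite {1}Yeq /r2 /r1 /r0 PE DE'; field.
have E0 : 0 <= E by apply: le_trans hE.
have E'0 : 0 <= E' by apply: le_trans hE'.
have h2d : h ^+ 2 / 2 <= d.
  have : h * h <= 1 * d by apply: ler_pM => //; lra.
  by rewrite -expr2 => ?; lra.
have h20 : 0 <= h ^+ 2 / 2 by rewrite mulr_ge0// sqr_ge0.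
have d0 : 0 <= d by lra.
have hd3 : h ^+ 3 <= d ^+ 3 by rewrite lerXn2r.
have Kh3 : K * h ^+ 3 <= K * d ^+ 3 by rewrite ler_wpM2l.
have -> : E + 2 * L * d * (E + E') + 3 * K * d ^+ 3 =
    E + d * (L * E' + L * E) + d * (L * E + L * E') + 3 * (K * d ^+ 3) by ring.
apply: le_trans (ler_normD _ _) _; apply: lerD.
  apply: le_trans (ler_normD _ _) _; apply: lerD.
    apply: le_trans (ler_normD _ _) _; apply: lerD => //.
    rewrite normrM ger0_norm// ler_pM//.
    by apply: le_trans (ler_normD _ _) _; apply: lerD; exact: lip.
  rewrite normrM ger0_norm// ler_pM//.
  by apply: le_trans (ler_normB _ _) _; apply: lerD; exact: lip.
have n1 : `|h * r1| <= K * h ^+ 3.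
  by rewrite normrM ger0_norm// exprS mulrCA ler_wpM2l.
have n0 : `|h ^+ 2 / 2 * r0| <= K * h ^+ 3.
  rewrite normrM ger0_norm//; apply: le_trans (_ : h ^+ 2 / 2 * (K * h) <= _).
    by rewrite ler_wpM2l.
  have -> : h ^+ 2 / 2 * (K * h) = K * h ^+ 3 / 2 by field.
  by rewrite ler_pdivrMr// ler_peMr ?ler1n// mulr_ge0// exprn_ge0.
apply: le_trans (ler_normB _ _) _; apply: le_trans (lerD (ler_normB _ _) n0) _.
by lra.
Qed.

(** Both iterates [Y] and [Yp] approximate the same value [wb], so the implicit correction terms
    vanish on the exact solution and cost only [L * d * E']: twice from the factor [d], once from
    [d ^+ 2 / 2 <= d / 2]. The defect [r] comes from the quadrature alone. *)
Lemma corrector_error (R : realType) (PhiI DI : R -> R)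
    (Y Yp y0 q qw wb wa d E E' L G r : R) :
  0 <= d <= 1 -> 0 <= L ->
  (forall x y, `|PhiI x - PhiI y| <= L * `|x - y|) ->
  (forall x y, `|DI x - DI y| <= L * `|x - y|) ->
  `|wb - wa - qw| <= r ->
  `|q - qw| <= G ->
  `|y0 - wa| <= E -> `|Y - wb| <= E' -> `|Yp - wb| <= E' ->
  Y = y0 + d * (PhiI Y - PhiI Yp) - d ^+ 2 / 2 * (DI Y - DI Yp) + q ->
  `|Y - wb| <= E + 3 * L * d * E' + G + r.
Proof.
move=> /andP[d0 d1] L0 lI lDI hr hG hE hY hYp Yeq.
have lip (f : R -> R) x y e : (forall x y, `|f x - f y| <= L * `|x - y|) ->
    `|x - y| <= e -> `|f x - f y| <= L * e.
  by move=> fL xye; apply: le_trans (fL _ _) _; rewrite ler_wpM2l.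
have -> : Y - wb = (y0 - wa)
    + (d * ((PhiI Y - PhiI wb) - (PhiI Yp - PhiI wb))
       - d ^+ 2 / 2 * ((DI Y - DI wb) - (DI Yp - DI wb)))
    + (q - qw) - (wb - wa - qw).
  by rewrite {1}Yeq; ring.
apply: le_trans (ler_normB _ _) _; apply: lerD => //.
apply: le_trans (ler_normD _ _) _; apply: lerD => //.
apply: le_trans (ler_normD _ _) _; apply: lerD => //.
have E'0 : 0 <= E' by apply: le_trans hY.
have d2 : d ^+ 2 / 2 <= d / 2 by rewrite ler_pM2r// expr2 ler_piMl.
have d20 : 0 <= d ^+ 2 / 2 by rewrite mulr_ge0// sqr_ge0.
have -> : 3 * L * d * E' = d * (L * E' + L * E') + d / 2 * (L * E' + L * E') by field.
apply: le_trans (ler_normB _ _) _; apply: lerD.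
  rewrite normrM ger0_norm// ler_wpM2l//.
  by apply: le_trans (ler_normB _ _) _; apply: lerD; exact: lip.
rewrite normrM ger0_norm// ler_pM//.
by apply: le_trans (ler_normB _ _) _; apply: lerD; exact: lip.
Qed.

(** * Convergence of the method *)

Lemma dotD (R : realType) (Phi f g : R -> R) x : smooth f -> smooth g ->
  dot Phi (f + g) x = dot Phi f x + dot Phi g x.
Proof.
move=> sf sg; rewrite /dot !derive1E deriveD ?mulrDl//; exact: smooth_derivable.
Qed.

(** As [c_s = 1], the last stage of block [n.+1] lies at the end of its step; with [w 0 = w0] the
    shifted index fits block 0 too. *)
Lemma exact_values_last (R : realType) (s : nat) (w : R -> R) (w0 d : R) (n k : nat) :
  (2 <= s)%N -> w 0 = w0 -> exact_values s w w0 d n k s = w (n%:R * d).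
Proof.
move=> s2 w0E; case: n => [|n]; rewrite /exact_values ?mul0r//.
by rewrite colloc_last// mul1r -addn1 natrD mulrDl mul1r.
Qed.

Theorem theorem1 (R : realType) (PhiI PhiE Phi : R -> R) (w0 Tend : R)
    (w : R -> R) (s kmax : nat) (B1 B2 : 'M[R]_s)
    (hT : 0 < Tend) (hs : (2 <= s)%N) (hk : (1 <= kmax)%N)
    (hPhi : forall x, Phi x = PhiI x + PhiE x)
    (hsl : smooth_lipschitz Phi)
    (hslI : smooth_lipschitz PhiI)
    (hslE : smooth_lipschitz PhiE)
    (hsld : smooth_lipschitz (dot Phi Phi))
    (hsldI : smooth_lipschitz (dot Phi PhiI))
    (hsldE : smooth_lipschitz (dot Phi PhiE))
    (hw : exact_solution Phi w0 Tend w)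
    (hB : hermite_butcher B1 B2) :
  exists C dt0 : R, 0 < dt0 /\
    forall N : nat, (0 < N)%N ->
    let dt := Tend / N%:R in
    dt <= dt0 ->
    forall y : nat -> nat -> nat -> R,
      HBPC PhiI PhiE Phi kmax B1 B2 w0 dt N y ->
      forall n : nat, (n <= N)%N ->
        `| stack kmax s (y n) - stack kmax s (exact_values s w w0 dt n) |
          <= C * dt ^+ 2.
Proof.
have [sPhi lPhi] := hsl; have [sI lI] := hslI; have [sE lE] := hslE.
have w00 : w 0 = w0 by case: hw.
have T0 : 0 <= Tend by exact: ltW.
have DE x : dot Phi Phi x = dot Phi PhiI x + dot Phi PhiE x.
  rewrite -dotD//; congr (dot Phi _ x).
  by apply/funext => z; rewrite hPhi.
have [L L0 [lipP lipI lipE lipDP [lipDI lipDE]]] : exists2 L : R, 0 <= L &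
  [/\ forall x y, `|Phi x - Phi y| <= L * `|x - y|,
      forall x y, `|PhiI x - PhiI y| <= L * `|x - y|,
      forall x y, `|PhiE x - PhiE y| <= L * `|x - y|,
      forall x y, `|dot Phi Phi x - dot Phi Phi y| <= L * `|x - y| &
      (forall x y, `|dot Phi PhiI x - dot Phi PhiI y| <= L * `|x - y|) /\
      forall x y, `|dot Phi PhiE x - dot Phi PhiE y| <= L * `|x - y|].
  have [L1 L10 h1] := lipschitz_bound lPhi.
  have [L2 L20 h2] := lipschitz_bound lI.
  have [L3 L30 h3] := lipschitz_bound lE.
  have [L4 L40 h4] := lipschitz_bound hsld.2.
  have [L5 L50 h5] := lipschitz_bound hsldI.2.
  have [L6 L60 h6] := lipschitz_bound hsldE.2.
  exists (L1 + L2 + L3 + L4 + L5 + L6); first by lra.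
  have up (a c : R) (f : R -> R) : a <= c ->
      (forall x y, `|f x - f y| <= a * `|x - y|) ->
      forall x y, `|f x - f y| <= c * `|x - y|.
    by move=> ac fa x y; apply: le_trans (fa x y) _; rewrite ler_wpM2r.
  by split; [apply: up h1|apply: up h2|apply: up h3|apply: up h4|
    split; [apply: up h5|apply: up h6]]; lra.
have [K K0 [t2 tP1 tI1 tP0 tI0]] : exists2 K : R, 0 <= K &
  [/\ forall a h : R, 0 <= a -> 0 <= h -> a + h <= Tend ->
        `|w (a + h) - w a - h * Phi (w a) - h ^+ 2 / 2 * dot Phi Phi (w a)|
          <= K * h ^+ 3,
      forall a h : R, 0 <= a -> 0 <= h -> a + h <= Tend ->
        `|Phi (w (a + h)) - Phi (w a) - h * dot Phi Phi (w a)| <= K * h ^+ 2,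
      forall a h : R, 0 <= a -> 0 <= h -> a + h <= Tend ->
        `|PhiI (w (a + h)) - PhiI (w a) - h * dot Phi PhiI (w a)| <= K * h ^+ 2,
      forall a h : R, 0 <= a -> 0 <= h -> a + h <= Tend ->
        `|dot Phi Phi (w (a + h)) - dot Phi Phi (w a)| <= K * h &
      forall a h : R, 0 <= a -> 0 <= h -> a + h <= Tend ->
        `|dot Phi PhiI (w (a + h)) - dot Phi PhiI (w a)| <= K * h].
  have [K1 K10 h1] := flow_taylor2 T0 sPhi hw hsld.2.
  have [K2 K20 h2] := flow_taylor1 T0 sPhi hw sPhi hsld.2.
  have [K3 K30 h3] := flow_taylor1 T0 sPhi hw sI hsldI.2.
  have [K4 K40 h4] := flow_lipschitz T0 sPhi hw hsld.2.
  have [K5 K50 h5] := flow_lipschitz T0 sPhi hw hsldI.2.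
  exists (K1 + K2 + K3 + K4 + K5); first by lra.
  split=> a h a0 h0 ahT; [apply: le_trans (h1 _ _ a0 h0 ahT) _|
    apply: le_trans (h2 _ _ a0 h0 ahT) _|apply: le_trans (h3 _ _ a0 h0 ahT) _|
    apply: le_trans (h4 _ _ a0 h0 ahT) _|apply: le_trans (h5 _ _ a0 h0 ahT) _];
    by rewrite ler_wpM2r ?exprn_ge0//; lra.
have b10 := mxnorm1_ge0 B1; have b20 := mxnorm1_ge0 B2.
set b1 := mxnorm1 B1 in b10 *; set b2 := mxnorm1 B2 in b20 *.
(* [A] dominates the predictor coefficients [2 * L], [3 * K] and the corrector coefficients
   [L * (3 + b1 + b2)], [K * (1 + b1 + b2)]. The added 1 gives [1 <= A], so that [A * d <= 1 / 2]
   forces [d <= 1]. *)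
pose A := (L + K) * (3 + b1 + b2) + 1.
have LK0 : 0 <= (L + K) * (3 + b1 + b2) by rewrite mulr_ge0//; lra.
have A1 : 1 <= A by rewrite /A; lra.
have A0 : 0 < A by lra.
(* The constant is the Gronwall factor at [n%:R * d <= Tend]; the step bound is the smallness
   condition of [implicit_gronwall]. *)
exists (expR (4 * A * Tend) / 2), (1 / 2 / A); split.
  by rewrite divr_gt0.
move=> N N0 d dA y hy n nN.
have NR0 : 0 < N%:R :> R by rewrite ltr0n.
have d0 : 0 <= d by rewrite divr_ge0// ltW.
have Ad : A * d <= 1 / 2 by rewrite mulrC -ler_pdivlMr.
have d1 : d <= 1 by have := ler_peMl d0 A1; lra.
have dT m : (m <= N)%N -> m%:R * d <= Tend.
  by move=> mN; rewrite mulrCA ler_piMr// ler_pdivrMr// mul1r ler_nat.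
set E := fun n => `|stack kmax s (y n) - stack kmax s (exact_values s w w0 d n)|.
have E_ge0 m : 0 <= E m by exact: normr_ge0.
have err m k l : (k <= kmax)%N -> (1 <= l <= s)%N ->
    `|y m k l - exact_values s w w0 d m k l| <= E m.
  by move=> kk ls; have /(stackB_leP _ _ _ _ (E_ge0 m)) := lexx (E m); apply.
have errs m k : (k <= kmax)%N -> `|y m k s - w (m%:R * d)| <= E m.
  move=> kk; rewrite -(exact_values_last d m k hs w00); apply: err => //.
  by rewrite leqnn (ltnW hs).
apply: le_trans (_ : expR (4 * A * (n%:R * d)) / 2 * d ^+ 2 <= _); last first.
  rewrite ler_wpM2r ?sqr_ge0// ler_pM2r// ler_expR ler_wpM2l//; last exact: dT.
  by rewrite mulr_ge0// ltW.
apply: (@implicit_gronwall _ E _ _ N) => //; first exact: ltW.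
  apply/eqP; rewrite normr_eq0 subr_eq0; apply/eqP; congr (_^T); congr mxvec.
  by apply/matrixP => k l; rewrite !mxE (hbpc_init hy)//= -ltnS; exact: ltn_ord.
move=> m mN.
have a0 : 0 <= m%:R * d by rewrite mulr_ge0.
have ahT (h : R) : 0 <= h <= d -> m%:R * d + h <= Tend.
  move=> /andP[_ hd]; apply: le_trans (dT m.+1 mN).
  by rewrite -addn1 natrD mulrDl mul1r lerD2l.
have dE0 : 0 <= d * E m by rewrite mulr_ge0.
have dE'0 : 0 <= d * E m.+1 by rewrite mulr_ge0.
have d30 : 0 <= d ^+ 3 by rewrite exprn_ge0.
have coefs : [/\ 0 <= L * b1, 0 <= L * b2, 0 <= K * b1 & 0 <= K * b2].
  by split; exact: mulr_ge0.
case: coefs => Lb1 Lb2 Kb1 Kb2.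
(* The common form to which the estimate of every entry is reduced. *)
have bnd (c1 c2 c3 : R) : c1 <= A -> c2 <= A -> c3 <= A ->
    E m + c1 * (d * E m) + c2 * (d * E m.+1) + c3 * d ^+ 3 <=
    E m + A * d * (E m + E m.+1) + A * d ^+ 3.
  move=> c1A c2A c3A; rewrite mulrDr addrA -!(mulrA A).
  by do !apply: lerD => //; rewrite ler_wpM2r.
have R0 : 0 <= E m + A * d * (E m + E m.+1) + A * d ^+ 3.
  have A0' := ltW A0; apply: addr_ge0; last exact: mulr_ge0.
  by apply: addr_ge0 => //; apply: mulr_ge0; [exact: mulr_ge0|exact: addr_ge0].
apply/stackB_leP => // -[|k] l kk ls.
  have /andP[l1 ls'] := ls.
  have hd : 0 <= colloc R s l * d <= d.
    by rewrite mulr_ge0 ?colloc_ge0//= ler_piMl// colloc_le1.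
  have /andP[h0 _] := hd.
  have pe := predictor_error hd d1 L0 K0 hPhi DE lipI lipE lipDI lipDE
    (t2 _ _ a0 h0 (ahT _ hd))
    (tI1 _ _ a0 h0 (ahT _ hd)) (tI0 _ _ a0 h0 (ahT _ hd)) (errs m 0%N isT)
    (err m.+1 0%N l isT ls) (hbpc_predictor hy mN ls).
  apply: le_trans pe _.
  have -> : E m + 2 * L * d * (E m + E m.+1) + 3 * K * d ^+ 3 =
    E m + (2 * L) * (d * E m) + (2 * L) * (d * E m.+1) + (3 * K) * d ^+ 3 by ring.
  by apply: bnd; rewrite /A; lra.
have mk : (minn k.+2 kmax <= kmax)%N by exact: geq_minr.
case: l ls => [|[|l]]// ls.
  (* The first corrected stage copies a final value of the previous step at the same time, so it
     only inherits that error. *)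
  rewrite (hbpc_corrector_first hy mN kk)/= colloc1 mul0r addr0.
  apply: le_trans (errs _ _ mk) _.
  have := bnd 0 0 0; rewrite !mul0r !addr0; apply; exact: ltW.
(* Stage [l.+2] belongs to row [l.+1] of the Butcher matrices. *)
pose i : 'I_s := Ordinal ls.
have hd : 0 <= colloc R s l.+2 * d <= d.
  by rewrite mulr_ge0 ?colloc_ge0//= ler_piMl// colloc_le1.
have sub (h : R) : 0 <= h <= d -> 0 <= h by case/andP.
have cons := @hermite_quad_consistent R s B1 B2 Phi w (m%:R * d) d K i hs isT hB d0 K0
  (fun h hd => t2 _ _ a0 (sub h hd) (ahT _ hd))
  (fun h hd => tP1 _ _ a0 (sub h hd) (ahT _ hd))
  (fun h hd => tP0 _ _ a0 (sub h hd) (ahT _ hd)).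
have lipq := @hermite_quad_lipschitz R s B1 B2 Phi d L (E m.+1) (y m.+1 k)
  (fun j => w (m%:R * d + colloc R s j * d)) i d0 L0 (E_ge0 _) lipP lipDP
  (fun j => err m.+1 k j.+1 (ltnW kk) (ltn_ord j)).
have d01 : 0 <= d <= 1 by rewrite d0.
have ce := corrector_error d01 L0 lipI lipDI cons lipq (errs _ _ mk)
  (err m.+1 k.+1 l.+2 kk ls) (err m.+1 k l.+2 (ltnW kk) ls)
  (hbpc_corrector hy mN kk (l := i) isT).
apply: le_trans ce _.
rewrite -/b1 -/b2.
apply: le_trans (_ : E m + 0 * (d * E m) + (L * (3 + b1 + b2)) * (d * E m.+1) +
  (K * (1 + b1 + b2)) * d ^+ 3 <= _); last by apply: bnd; rewrite /A; lra.
(* The [B2] part of the quadrature stability carries [d ^+ 2]; as [d <= 1] it is absorbed into the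
   coefficient of [d * E m.+1]. *)
have d2 : d ^+ 2 <= d by rewrite expr2 ler_piMl.
have := ler_wpM2r (mulr_ge0 Lb2 (E_ge0 m.+1)) d2.
lra.
Qed.
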